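(* For every integer $q>2$ there exists an orientable sequence of order $3$ over $\mathbb{Z}_q$ with period at least \[ \begin{cases} q\bigl(\tfrac{q(q-1)}{2}-1\bigr) & \text{if $q$ is odd},\\ q\bigl(\tfrac{q(q-1)}{2}-2\bigr) & \text{if $q$ is even and } q\neq 6,\\ q\bigl(\tfrac{q(q-1)}{2}-3\bigr) & \text{if } q=6. \end{cases} \]
   Context: Sequences are periodic with entries in $\mathbb{Z}_q$. For a sequence $S=(s_i)$ write $\mathbf{s}_n(i)=(s_i,\ldots,s_{i+n-1})$, and for an $n$-tuple $\mathbf{u}=(u_0,\ldots,u_{n-1})$ let $\mathbf{u}^R=(u_{n-1},\ldots,u_0)$. A periodic sequence $S$ of period $m$ is an $n$-window sequence if $\mathbf{s}_n(i)=\mathbf{s}_n(j)$ implies $i\equiv j\pmod m$. An $n$-window sequence is an orientable sequence of order $n$ if $\mathbf{s}_n(i)\neq \mathbf{s}_n(j)^R$ for all $i,j$. (The paper obtains such a sequence by a specific construction: a maximal-period negative orientable sequence of order 2, possibly shortened to have unit weight, lifted by the inverse Lempel homomorphism.) *)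

(* Defs.v *)
From HB Require Import structures.
From mathcomp Require Import all_boot all_order all_algebra.

Set Implicit Arguments.
Unset Strict Implicit.
Unset Printing Implicit Defensive.

(* 'Z_q is the ring of integers mod q only when q > 1. *)

Definition window (q : nat) (s : nat -> 'Z_q) (n i : nat) : n.-tuple 'Z_q :=
  [tuple s (i + k) | k < n].

(* The period is the least positive one. *)
Definition has_period (q : nat) (s : nat -> 'Z_q) (m : nat) : Prop :=
  [/\ 0 < m,
      forall i, s (i + m) = s i &
      forall p, 0 < p -> (forall i, s (i + p) = s i) -> m <= p].

Definition window_sequence (q n m : nat) (s : nat -> 'Z_q) : Prop :=
  has_period s m /\
  forall i j, window s n i = window s n j -> i = j %[mod m].

Definition orientable (q n m : nat) (s : nat -> 'Z_q) : Prop :=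
  window_sequence n m s /\
  forall i j, window s n i <> [tuple of rev (window s n j)].

(* For q > 2 the division is exact and no subtraction is truncated. *)
Definition order3_bound (q : nat) : nat :=
  if odd q then q * ((q * (q - 1)) %/ 2 - 1)
  else if q != 6 then q * ((q * (q - 1)) %/ 2 - 2)
  else q * ((q * (q - 1)) %/ 2 - 3).

(* Main.v *)
Require Import Defs.
From mathcomp Require Import all_boot all_order all_algebra.
From mathcomp Require Import perm zify ring.

(** An orientable sequence of order 3 is a closed trail in the de Bruijn graph,
    with vertices the pairs and edges the triples over Z_q, that meets each
    class {(a, b, c), (c, b, a)} at most once.  Let E be the set of triples with
    c - a in {1, ..., ceil(q/2) - 1}, together with, for even q, those with
    c - a = q/2 and b - a in {1, ..., q/2 - 1}.  E is disjoint from its reversal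
    and stable under (a, b, c) |-> (b, c, b + c - a), so this map splits E into
    closed trails.  Two trails meeting at a vertex can be merged by composing
    the successor permutation with a transposition; for q >= 5 the graph E is
    connected, so E is a single closed trail, of length q^2 (q-1) / 2 for odd q
    and q (q (q-1) / 2 - 1) for even q.  For q = 3 and q = 4 the sequence is
    given explicitly. *)

Set Implicit Arguments.
Unset Strict Implicit.
Unset Printing Implicit Defensive.

(** * Merging the cycles of a successor permutation *)

Section EulerCircuit.

Variables (T : finType) (V : eqType) (tail head : T -> V) (E : {set T}).

Definition edge_successor (s : {perm T}) : Prop :=
  (forall x, (s x \in E) = (x \in E)) /\
  {in E, forall x, tail (s x) = head x}.

(** Induction on the number of cycles. Swapping the successors of two edges with equal heads keeps
    the successor property. *)
Lemma merge_cycles (s0 : {perm T}) : edge_successor s0 ->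
  exists2 s : {perm T}, edge_successor s &
    {in E &, forall x y, head x = head y -> porbit s x = porbit s y}.
Proof.
have [n] := ubnP #|porbits s0|; elim: n s0 => // n IHn s lt_s_n [sE s_tail].
case: (boolP [exists x in E, exists y in E,
  (head x == head y) && (x \notin porbit s y)]); last first.
  rewrite negb_exists_in => /forall_inP noE; exists s => // x y xE yE hxy.
  have := noE x xE; rewrite negb_exists_in => /forall_inP /(_ y yE).
  by rewrite hxy eqxx negbK -eq_porbit_mem => /eqP.
case/exists_inP=> x xE /exists_inP[y yE /andP[/eqP hxy nxy]].
have neq_xy: x != y by apply: contraNneq nxy => ->; apply: porbit_id.
(* Since [x] and [y] lie in distinct cycles, the transposition lowers the number of cycles by
   one. *)
have := porbits_mul_tperm s x y; rewrite /= nxy neq_xy addn1 addn2 => -[card_s].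
apply: (IHn (tperm x y * s)%g).
  by rewrite card_s.
split=> z; rewrite permM.
  by case: tpermP => [->|->|_ _]; rewrite sE ?xE ?yE.
by case: tpermP => [->|->|_ _] zE; rewrite s_tail.
Qed.

End EulerCircuit.

Lemma iter_porbit_inj (T : finType) (s : {perm T}) x i j :
  iter i s x = iter j s x -> i = j %[mod #|porbit s x|].
Proof.
set m := #|_|; have m_gt0: 0 < m by rewrite lt0n card_porbit_neq0.
have iter_mod k : iter k s x = iter (k %% m) s x.
  rewrite {1}(divn_eq k m) addnC iterD; congr iter.
  by elim: (k %/ m) => // d IHd; rewrite mulSn iterD IHd iter_porbit.
rewrite iter_mod (iter_mod j) => eq_ij; apply/eqP.
rewrite -(nth_uniq x _ _ (uniq_traject_porbit s x)) ?size_traject ?ltn_pmod //.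
by rewrite !nth_traject ?ltn_pmod // eq_ij.
Qed.

(** * Criteria for orientability of order 3 *)

Section OrderThree.

Variable q : nat.

Lemma orientable3P m (s : nat -> 'Z_q) : 0 < m ->
  (forall i, s (i + m) = s i) ->
  (forall i j, s i = s j -> s i.+1 = s j.+1 -> s i.+2 = s j.+2 ->
     i = j %[mod m]) ->
  (forall i j, s i = s j.+2 -> s i.+1 = s j.+1 -> s i.+2 = s j -> False) ->
  orientable 3 m s.
Proof.
move=> m_gt0 s_m s_inj s_rev.
have winE i k (lt_k3 : k < 3) : tnth (window s 3 i) (Ordinal lt_k3) = s (i + k).
  by rewrite tnth_mktuple.
have win_inj i j : window s 3 i = window s 3 j -> i = j %[mod m].
  move=> eq_ij; apply: s_inj.
  - by have := winE i 0 isT; rewrite eq_ij winE !addn0.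
  - by have := winE i 1 isT; rewrite eq_ij winE !addn1.
  - by have := winE i 2 isT; rewrite eq_ij winE !addn2.
split; first split=> //.
  (* A period [p] gives equal windows at [p] and 0, so [m] divides [p]. *)
  split=> // p p_gt0 s_p; apply: dvdn_leq p_gt0 _.
  rewrite /dvdn -[0](mod0n m); apply/eqP/win_inj/eq_from_tnth => k.
  by rewrite !tnth_mktuple add0n addnC s_p.
move=> i j eq_ij.
have seqE k : tval (window s 3 k) = [:: s k; s k.+1; s k.+2].
  apply: (@eq_from_nth _ (s 0)); first by rewrite size_tuple.
  move=> l; rewrite size_tuple => lt_l3; rewrite -[l]/(val (Ordinal lt_l3)).
  rewrite -tnth_nth winE.
  by case: l lt_l3 => [|[|[|]]] //= _; rewrite ?addn0 ?addn1 ?addn2.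
have := congr1 val eq_ij; rewrite /= !seqE /rev /= => -[].
exact: s_rev.
Qed.

(** The check is boolean and over [nat], so that it runs by evaluation on a concrete list. *)
Lemma orientable3_of_seq (l : seq nat) (m := size l)
    (t := fun i => nth 0 l (i %% m)) :
  1 < q -> 0 < m -> all (fun a => a < q) l ->
  all (fun i => all (fun j =>
    ([&& t i == t j, t i.+1 == t j.+1 & t i.+2 == t j.+2] ==> (i == j)) &&
    ~~ [&& t i == t j.+2, t i.+1 == t j.+1 & t i.+2 == t j]) (iota 0 m))
    (iota 0 m) ->
  orientable 3 m (fun i => inZp (t i) : 'Z_q).
Proof.
move=> q_gt1 m_gt0 /allP lt_lq /allP chk.
have t_mod i k : t (i + k) = t (i %% m + k) by rewrite /t modnDml.
have tS1 i : t i.+1 = t (i %% m).+1 by rewrite -addn1 t_mod addn1.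
have tS2 i : t i.+2 = t (i %% m).+2 by rewrite -addn2 t_mod addn2.
have tS0 i : t i = t (i %% m) by rewrite -[i in LHS]addn0 t_mod addn0.
have t_lt i : t i < q by apply: lt_lq; rewrite mem_nth ?ltn_pmod.
have inZp_inj i j : inZp (t i) = inZp (t j) :> 'Z_q -> t i = t j.
  by move/(congr1 val); rewrite /= !Zp_cast // !modn_small.
have in_m i : i %% m \in iota 0 m by rewrite mem_iota ltn_pmod.
have chk2 i j := allP (chk _ (in_m i)) _ (in_m j).
apply: orientable3P => // [i|i j|i j].
- by rewrite {1}/t modnDr.
- move=> /inZp_inj e0 /inZp_inj e1 /inZp_inj e2.
  have := chk2 i j.
  by rewrite -!tS0 -!tS1 -!tS2 e0 e1 e2 !eqxx => /andP[/eqP].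
move=> /inZp_inj e0 /inZp_inj e1 /inZp_inj e2.
have := chk2 i j.
by rewrite -!tS0 -!tS1 -!tS2 e0 e1 e2 !eqxx /= andbF.
Qed.

End OrderThree.

(** * The graph of admissible triples *)

Section Triples.

Import GRing.Theory.
Local Open Scope ring_scope.

Variable n : nat.
Let q := n.+2.
Local Notation Zq := 'I_n.+2.

(* In terms of e = b - a and d = c - a, so that E is invariant under
   translation of the triples. *)
Definition admissible (e d : Zq) : bool :=
  (0 < d.*2 < q)%N || ((d.*2 == q)%N && (0 < e.*2 < q)%N).

Definition edges : {set Zq * Zq * Zq} :=
  [set x | admissible (x.1.2 - x.1.1) (x.2 - x.1.1)].

Lemma val_subZp (x y : Zq) :
  (x - y)%R = (if y <= x then x - y else x + q - y)%N :> nat.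
Proof.
have := ltn_ord x; have := ltn_ord y; move=> ltx lty /=.
rewrite modnDmr; case: leqP => [le_yx|lt_xy].
  by rewrite addnBA ?(ltnW ltx) // addnC -addnBA // modnDl modn_small //; lia.
by rewrite modn_small addnBA //; lia.
Qed.

Lemma admissible_next (e d : Zq) : admissible (d - e) d = admissible e d.
Proof.
have lt_e := ltn_ord e; have lt_d := ltn_ord d.
by rewrite /admissible val_subZp /q; case: (leqP e d); lia.
Qed.

(** If 0 < 2d < q, then -d is represented by q - d, which exceeds q/2. If 2d = q, then -d = d, but e
    - d is represented by e + q/2, which exceeds q/2. *)
Lemma admissible_rev (e d : Zq) : admissible e d -> ~~ admissible (e - d) (- d).
Proof.
have lt_e := ltn_ord e; have lt_d := ltn_ord d.
rewrite -[X in ~~ admissible _ X]add0r /admissible !val_subZp /q /=.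
by case: (leqP d e); case: (leqP d 0); lia.
Qed.

Lemma edges_rev a b c : (a, b, c) \in edges -> (c, b, a) \notin edges.
Proof.
rewrite !inE /= => /admissible_rev.
by rewrite opprB addrA subrK.
Qed.

Definition next_triple (x : Zq * Zq * Zq) := (x.1.2, x.2, x.1.2 + x.2 - x.1.1).

Lemma next_triple_inj : injective next_triple.
Proof.
move=> [[a b] c] [[a' b'] c'] /eqP; rewrite !xpair_eqE /=.
by move=> /andP[/andP[/eqP-> /eqP->] /eqP/addrI/oppr_inj->].
Qed.

Lemma next_triple_edges x : (next_triple x \in edges) = (x \in edges).
Proof.
case: x => [[a b] c]; rewrite !inE /= -[RHS]admissible_next.
congr admissible; last by rewrite addrAC [b + c]addrC addrK.
by rewrite opprB addrA subrK.
Qed.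

Lemma card_halves : #|[set d : Zq | (0 < d.*2 < q)%N]| = n.+1./2.
Proof.
have lt_q (i : 'I_n.+1./2) : (i.+1 < n.+2)%N by have := ltn_ord i; lia.
have -> : [set d : Zq | (0 < d.*2 < q)%N] =
          [set Ordinal (lt_q i) | i : 'I_n.+1./2].
  apply/setP=> d; rewrite inE; apply/idP/imsetP => [d_half|[i _ ->]] /=.
    have lt_d : (d.-1 < n.+1./2)%N by rewrite /q in d_half; lia.
    by exists (Ordinal lt_d) => //; apply: val_inj => /=; lia.
  by case: i => i /=; rewrite /q; lia.
by rewrite card_imset ?card_ord // => i j [] /val_inj.
Qed.

Lemma card_middle : #|[set d : Zq | d.*2 == q]| = ~~ odd q.
Proof.
have [odd_q|even_q] := boolP (odd q).
  apply/eqP; rewrite cards_eq0; apply/eqP/setP => d; rewrite !inE.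
  by apply/eqP=> dq; move: odd_q; rewrite -dq odd_double.
have lt_q : (n.+2./2 < n.+2)%N by lia.
rewrite (_ : [set d | _] = [set Ordinal lt_q]) ?cards1 //.
apply/setP=> d; rewrite !inE -val_eqE /=; move: even_q; rewrite /q; lia.
Qed.

Lemma card_edges : #|edges| = (q * (n.+1./2 * (q + ~~ odd q)))%N.
Proof.
pose g (x : Zq * Zq * Zq) := (x.1.1, x.1.2 - x.1.1, x.2 - x.1.1).
have g_inj : injective g.
  move=> [[a b] c] [[a' b'] c'] /eqP; rewrite !xpair_eqE /=.
  by move=> /andP[/andP[/eqP-> /eqP/addIr->] /eqP/addIr->].
(* [H] serves twice: for d with e free, and for e when d = q/2. *)
pose H := [set d : Zq | (0 < d.*2 < q)%N].
pose M := [set d : Zq | (d.*2 == q)%N].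
have -> : edges = g @^-1: (setX setT H :|: setX (setX setT H) M).
  apply/setP=> -[[a b] c]; rewrite !inE /= /admissible; congr (_ || _).
  exact: andbC.
rewrite card_preimset // cardsU [in X in (_ - X)%N](_ : _ :&: _ = set0).
  rewrite cards0 subn0 !cardsX !cardsT card_prod card_ord card_halves card_middle.
  by rewrite -/q; ring.
apply/setP=> -[[a b] c]; rewrite !inE /=; apply/negbTE.
by rewrite /q; lia.
Qed.

(** As q >= 5, the differences c - a = 1 and 2 are admissible for every b. From the vertex (a, b)
    one thus reaches both (b, a + 1) and (b, a + 2), which makes [u b] constant; then
    [u a b = u b (a + 1)] removes the other argument. *)
Lemma edges_connected (rT : Type) (f : Zq * Zq * Zq -> rT) : (2 < n)%N ->
  {in edges &, forall x y, x.1 = y.1 -> f x = f y} ->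
  {in edges &, forall x y, (x.1.2, x.2) = y.1 -> f x = f y} ->
  {in edges &, forall x y, f x = f y}.
Proof.
move=> n_gt2 f_tail f_head.
have E1 a b : (a, b, a + 1) \in edges.
  rewrite inE /= [a + 1]addrC addrK /admissible /= (@modn_small 1) //.
  by rewrite /q; lia.
have E2 a b : (a, b, a + 1 + 1) \in edges.
  rewrite inE /= -[a + 1 + 1]addrA [a + _]addrC addrK /admissible /=.
  by rewrite (@modn_small 1) // (@modn_small (1 + 1)%N) /q; lia.
pose u a b := f (a, b, a + 1).
have u_next a b : u a b = u b (a + 1) by apply: f_head.
have u_step a b : u b (a + 1) = u b (a + 1 + 1).
  rewrite -u_next /u (f_tail _ (a, b, a + 1 + 1)) //; exact: f_head.
have u_const b x : u b x = u b 0.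
  rewrite -[x]natr_Zp; elim: (x : nat) => // k IHk.
  by rewrite -IHk -[k%:R](subrK 1) u_step subrK -natr1.
have u_all a b : u a b = u 0 0.
  by rewrite u_const u_next u_const.
suff f_u x : x \in edges -> f x = u 0 0 by move=> x y xE yE; rewrite !f_u.
by case: x => [[a b] c] xE; rewrite (f_tail _ (a, b, a + 1)) // -(u_all a b).
Qed.

End Triples.

(** * The single closed trail and the resulting sequence *)

Lemma orientable3_edges (n : nat) : 2 < n ->
  exists s : nat -> 'Z_n.+2, orientable 3 #|edges n| s.
Proof.
move=> n_gt2; pose E := edges n.
pose tail (x : 'I_n.+2 * 'I_n.+2 * 'I_n.+2) := x.1.
pose head (x : 'I_n.+2 * 'I_n.+2 * 'I_n.+2) := (x.1.2, x.2).
have [|s [sE s_tail] s_head] := @merge_cycles _ _ tail head E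
  (perm (@next_triple_inj n)).
  by split=> [x|x _]; rewrite permE ?next_triple_edges.
have orb_s x : porbit s (s x) = porbit s x by exact: (porbit_perm s 1).
have s_join : {in E &, forall x y, head x = tail y -> porbit s x = porbit s y}.
  move=> x y xE yE; rewrite -[y](permKV s) => hxy.
  (* The predecessor of [y] has the same head as [x], hence lies in its cycle. *)
  have zE : (s^-1)%g y \in E by rewrite -sE permKV.
  by rewrite orb_s; apply: s_head => //; rewrite hxy s_tail.
have s_fork : {in E &, forall x y, tail x = tail y -> porbit s x = porbit s y}.
  move=> x y xE yE txy; have zE : (s^-1)%g x \in E by rewrite -sE permKV.
  rewrite -[x](permKV s) orb_s; apply: s_join => //.
  by rewrite -s_tail ?permKV.
have one_orbit := edges_connected n_gt2 s_fork s_join.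
have [x0 x0E] : exists x0, x0 \in E.
  by apply/card_gt0P; rewrite card_edges !muln_gt0; lia.
have iterE i : iter i s x0 \in E by elim: i => //= i IHi; rewrite sE.
have orbE : porbit s x0 = E.
  apply/setP=> y; apply/idP/idP => [/porbitP[i ->]|yE].
    by rewrite permX.
  by rewrite -eq_porbit_mem; apply/eqP/one_orbit.
pose t i : 'Z_n.+2 := (iter i s x0).1.1.
have iter_t i : iter i s x0 = (t i, t i.+1, t i.+2).
  rewrite /t /=; have := s_tail _ (iterE i); have := s_tail _ (iterE i.+1).
  rewrite /tail /head /=; by case: (iter i s x0) => [[a b] c] /= -> ->.
exists t; apply: orientable3P => [|i|i j e0 e1 e2|i j e0 e1 e2].
- by rewrite -/E -orbE lt0n card_porbit_neq0.
- by rewrite /t iterD -/E -{1}orbE iter_porbit.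
- by rewrite -/E -orbE; apply: iter_porbit_inj; rewrite !iter_t e0 e1 e2.
have := iterE i; rewrite iter_t e0 e1 e2 => /edges_rev.
by rewrite -iter_t -/E iterE.
Qed.

Lemma order3_bound_le n : order3_bound n.+2 <= #|edges n|.
Proof.
rewrite card_edges /order3_bound.
have [odd_n|even_n] := boolP (odd n.+2).
  have -> : n.+2 * (n.+2 - 1) %/ 2 = n.+2 * n.+1./2.
    by rewrite -divn2 muln_divA ?subSS ?subn0 // dvdn2; lia.
  by rewrite addn0 leq_mul2l mulnC leq_subr.
have -> : n.+2 * (n.+2 - 1) %/ 2 = n.+2./2 * n.+1.
  by rewrite -divn2 divn_mulAC ?subSS ?subn0 // dvdn2.
have [k ->] : exists k, n = k.*2 by exists n./2; lia.
have -> : k.*2.+1./2 = k by lia.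
have -> : k.*2.+2./2 = k.+1 by lia.
(* With q = 2k + 2, the edge count over q is k(2k + 3) = (k + 1)(2k + 1) - 1, that is q(q - 1)/2 -
   1. *)
by case: ifP => _; rewrite leq_mul2l; nia.
Qed.

Theorem theorem4 (q : nat) (hq : 2 < q) :
  exists (m : nat) (s : nat -> 'Z_q),
    orientable 3 m s /\ order3_bound q <= m.
Proof.
case: q hq => [|[|[|[|[|n]]]]] // _.
(* The lists for q = 3 and q = 4 have lengths 6 and 16, exactly the bounds. *)
- by do 2![eexists]; split; first exact: (@orientable3_of_seq 3
    [:: 0; 0; 1; 1; 2; 2]).
- by do 2![eexists]; split; first exact: (@orientable3_of_seq 4
    [:: 0; 1; 3; 2; 2; 1; 3; 0; 2; 3; 0; 1; 2; 3; 3; 0]).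
have [//|s s_ori] := @orientable3_edges n.+3.
by exists #|edges n.+3|, s; split; last exact: order3_bound_le.
Qed.
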